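(* Let $\mathbf n=(n_1,n_2,\dots)$ be any sequence of positive integers, with $\mathcal P$, $\Psi_L$, $\vec\ell=(\ell_1,\ell_2,\ell_3)$, $\mathcal R$, $\mathcal R_1,\mathcal R_2,\mathcal R_3$ and the paths $\Gamma_{min},\Gamma_{3max},\Gamma_{2min},\Gamma_{2max},\Gamma_{1min},\Gamma_{max}$ as defined in the context. Each subpiece $\mathcal R_a$ ($a=1,2,3$) of $\mathcal R$ is contained in an interval $J_a$ and any two of these intervals intersect in at most one point. Specifically, $$0=\Psi_L(\Gamma_{min})\le\mathcal R_3\le\Psi_L(\Gamma_{3max})=-\ell_2=\Psi_L(\Gamma_{2min})\le\mathcal R_2\le\Psi_L(\Gamma_{2max})=-\ell_1=\Psi_L(\Gamma_{1min})\le\mathcal R_1\le\Psi_L(\Gamma_{max})=\ell_3-\ell_2,$$ where an inequality involving a set means the inequality for all its elements. Further, the paths that achieve the extremes are only those given: $\Psi_L^{-1}(0)=\{\Gamma_{min}\}$, $\Psi_L^{-1}(\mathcal R_3\cap\mathcal R_2)=\{\Gamma_{3max},\Gamma_{2min}\}$, $\Psi_L^{-1}(\mathcal R_2\cap\mathcal R_1)=\{\Gamma_{2max},\Gamma_{1min}\}$, and $\Psi_L^{-1}(\ell_3-\ell_2)=\{\Gamma_{max}\}$.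
   Context: The alphabet is $\{1,2,3\}$, $\epsilon$ is the empty word, $1^m$ is the letter $1$ repeated $m$ times. For a positive integer $n$, $\Lambda_n$ is the substitution $1\mapsto 2,\ 2\mapsto 31^{n+1},\ 3\mapsto 31^n$. Fix $\mathbf n=(n_1,n_2,\dots)$, $n_i\ge1$; $\Lambda^{(k)}=\Lambda_{n_1}\circ\dots\circ\Lambda_{n_k}$. $\mathcal P$ is the set of sequences $\Gamma=(u_i,a_i,v_i)_{i\ge0}$ with $a_i\in\{1,2,3\}$, $u_i,v_i$ possibly empty words, and $\Lambda_{n_{i+1}}(a_{i+1})=u_ia_iv_i$ for all $i\ge0$. $A_n=\begin{pmatrix}0&n+1&n\\1&0&0\\0&1&1\end{pmatrix}$, $A^{(k)}=A_{n_1}\cdots A_{n_k}$, $\mathcal C_{-,-,+}=\{x\in\mathbb R^3:x_1<0,x_2<0,x_3>0\}$. $\vec\ell=(\ell_1,\ell_2,\ell_3)\in\mathcal C_{-,-,+}$ is the unit vector such that $(A^{(k)})^{-T}w/\|(A^{(k)})^{-T}w\|_2\to\vec\ell$ for every $w\in\mathcal C_{-,-,+}$ (it exists; $-T$ denotes inverse transpose). For a finite word $w$, $\phi(w)=\sum_{a=1}^3\ell_a|w|_a$, where $|w|_a$ is the number of letters $a$ in $w$; $\phi(\epsilon)=0$. $\Psi_L:\mathcal P\to\mathbb R$ is $\Psi_L(\Gamma)=\phi(u_0)+\sum_{j=1}^\infty\phi(\Lambda^{(j)}(u_j))$ (a convergent series). The (generalized) Rauzy fractal is $\mathcal R=\Psi_L(\mathcal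 P)$ with subpieces $\mathcal R_a=\Psi_L(\{\Gamma\in\mathcal P:a_0=a\})$, $a=1,2,3$. The special paths are (products denote concatenation of edge labels): $\Gamma_{min}=\prod_{i\ge1}(\epsilon,3,1^{n_i})$; $\Gamma_{3max}=(\epsilon,3,1^{n_1+1}),\prod_{i\ge1}\big((\epsilon,2,\epsilon),(3,1,1^{n_{2i+1}})\big)$; $\Gamma_{2min}=\prod_{i\ge1}\big((\epsilon,2,\epsilon),(31^{n_{2i}},1,\epsilon)\big)$; $\Gamma_{2max}=\prod_{i\ge1}\big((\epsilon,2,\epsilon),(3,1,1^{n_{2i}})\big)$; $\Gamma_{1min}=(31^{n_1},1,\epsilon),\prod_{i\ge1}\big((\epsilon,2,\epsilon),(31^{n_{2i+1}},1,\epsilon)\big)$; $\Gamma_{max}=\prod_{i\ge1}\big((3,1,1^{n_{2i-1}}),(\epsilon,2,\epsilon)\big)$. *)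

(* Defs.v *)
From mathcomp Require Import all_boot all_order all_algebra.
From mathcomp Require Import all_classical all_reals all_analysis.

Set Implicit Arguments.
Unset Strict Implicit.
Unset Printing Implicit Defensive.

Import Order.TTheory GRing.Theory Num.Theory.
Import numFieldNormedType.Exports.

Local Open Scope classical_set_scope.
Local Open Scope ring_scope.

(* The letters 1, 2, 3 are the elements 0, 1, 2 of 'I_3, so that they also     *)
(* index the coordinates of vectors of R^3.                                    *)
Definition letter := 'I_3.
Definition L1 : letter := @Ordinal 3 0 isT.
Definition L2 : letter := @Ordinal 3 1 isT.
Definition L3 : letter := @Ordinal 3 2 isT.

Definition word := seq letter.

Definition Lambda_letter (m : nat) (a : letter) : word :=
  match val a with
  | 0 => [:: L2]
  | 1 => L3 :: nseq m.+1 L1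
  | _ => L3 :: nseq m L1
  end%N.

Definition Lambda (m : nat) (w : word) : word :=
  flatten [seq Lambda_letter m a | a <- w].

(* Throughout, a sequence (n_1, n_2, ...) is a function n : nat -> nat whose   *)
(* value n 0 is never used.                                                    *)

(* Lambda_(n_1) \o ... \o Lambda_(n_k)                                         *)
Fixpoint LambdaK (n : nat -> nat) (k : nat) (w : word) : word :=
  if k is k'.+1 then LambdaK n k' (Lambda (n k) w) else w.

(* The edge label (u, a, v) is the triple ((u, a), v).                         *)
Definition edge_path := nat -> word * letter * word.

Definition path_u (G : edge_path) (i : nat) : word := (G i).1.1.
Definition path_a (G : edge_path) (i : nat) : letter := (G i).1.2.
Definition path_v (G : edge_path) (i : nat) : word := (G i).2.

Definition paths (n : nat -> nat) : set edge_path :=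
  [set G | forall i : nat,
     Lambda_letter (n i.+1) (path_a G i.+1)
     = path_u G i ++ path_a G i :: path_v G i].

Section Real.
Variable R : realType.

Definition Amx (m : nat) : 'M[R]_3 :=
  \matrix_(i < 3, j < 3)
    nth 0 (nth [::] [:: [:: 0; m.+1%:R; m%:R];
                        [:: 1; 0;       0];
                        [:: 0; 1;       1]] i) j.

(* The product is ordered: A_(n_1) * ... * A_(n_k).                            *)
Definition AmxK (n : nat -> nat) (k : nat) : 'M[R]_3 :=
  \prod_(1 <= i < k.+1) Amx (n i).

Definition cone_mmp : set 'cV[R]_3 :=
  [set x | [/\ x L1 0 < 0, x L2 0 < 0 & 0 < x L3 0]].

(* The library norm on matrices is the sup norm.                               *)
Definition norm2 (x : 'cV[R]_3) : R := Num.sqrt (\sum_(a < 3) x a 0 ^+ 2).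

Definition is_ell (n : nat -> nat) (ell : 'cV[R]_3) : Prop :=
  [/\ cone_mmp ell,
      norm2 ell = 1 &
      forall w : 'cV[R]_3, cone_mmp w ->
        (fun k : nat => (norm2 ((invmx (AmxK n k))^T *m w))^-1
                          *: ((invmx (AmxK n k))^T *m w)) @ \oo --> ell].

Definition phi (ell : 'cV[R]_3) (w : word) : R :=
  \sum_(a < 3) ell a 0 * (count_mem a w)%:R.

Definition PsiL (n : nat -> nat) (ell : 'cV[R]_3) (G : edge_path) : R :=
  phi ell (path_u G 0)
  + limn (fun N : nat => \sum_(1 <= j < N) phi ell (LambdaK n j (path_u G j))).

Definition rauzy_piece (n : nat -> nat) (ell : 'cV[R]_3) (a : letter) : set R :=
  PsiL n ell @` [set G | paths n G /\ path_a G 0 = a].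

End Real.

(* Each special path is described by its i-th edge, i >= 0; the entry of n     *)
(* occurring in that edge is always n_(i+1).                                   *)
Definition Gmin (n : nat -> nat) : edge_path :=
  fun i => ([::], L3, nseq (n i.+1) L1).

Definition G3max (n : nat -> nat) : edge_path :=
  fun i => if i == 0%N then ([::], L3, nseq (n i.+1).+1 L1)
           else if odd i then ([::], L2, [::])
           else ([:: L3], L1, nseq (n i.+1) L1).

Definition G2min (n : nat -> nat) : edge_path :=
  fun i => if odd i then (L3 :: nseq (n i.+1) L1, L1, [::])
           else ([::], L2, [::]).

Definition G2max (n : nat -> nat) : edge_path :=
  fun i => if odd i then ([:: L3], L1, nseq (n i.+1) L1)
           else ([::], L2, [::]).

Definition G1min (n : nat -> nat) : edge_path :=
  fun i => if odd i then ([::], L2, [::])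
           else (L3 :: nseq (n i.+1) L1, L1, [::]).

Definition Gmax (n : nat -> nat) : edge_path :=
  fun i => if odd i then ([::], L2, [::])
           else ([:: L3], L1, nseq (n i.+1) L1).

(* Main.v *)
Require Import Defs.
From mathcomp Require Import all_boot all_order all_algebra.
From mathcomp Require Import all_classical all_reals all_analysis.
From mathcomp Require Import ring lra.

Set Implicit Arguments.
Unset Strict Implicit.
Unset Printing Implicit Defensive.

Import Order.TTheory GRing.Theory Num.Theory.
Import numFieldNormedType.Exports.

Local Open Scope classical_set_scope.
Local Open Scope ring_scope.

(* Put l^(k) = (A^(k))^T l, so that phi (Lambda^(k) w) is the weight of w for *)
(* l^(k).  As l is a limit of vectors (A^(j))^-T w, every l^(k) lies in the   *)
(* closed cone C_{-,-,+}, and then in the open one.  The recursion for l^(k)  *)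
(* gives -l^(k)_1 >= -l^(k+1)_1 - l^(k+2)_1, hence l^(k) tends to 0.          *)
(* Let lo_k a and hi_k a be the claimed end points of J_a, computed from l^(k). *)
(* An edge (u, a, v) of Lambda_{n_(k+1)} b satisfies                          *)
(*   lo_k a <= phi (Lambda^(k) u) + lo_(k+1) b and                            *)
(*   phi (Lambda^(k) u) + hi_(k+1) b <= hi_k a.                               *)
(* Telescoping along a path bounds Psi_L by lo_0 and hi_0, with equality only *)
(* if every edge is tight; for each a exactly one edge is tight for lo, and one *)
(* for hi, so the extremal paths are determined by their first letter.        *)

(** The end points act as a potential along a path. [Lambda_split_bounds] shows that each edge has
    nonnegative slack and names the edges of slack zero. [potential_bound] adds the slacks up to the
    distance between Psi_L and the end point; the boundary term vanishes in the limit by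
    [ellK_cvg0], and the signs come from [ellK_cone]. So an extreme value is reached exactly by a
    path all of whose edges are tight, and [follows_inj] says that its first letter determines such
    a path. Neighbouring intervals share one end point, hence a value common to two pieces is the
    maximum of one and the minimum of the other, which gives exactly two paths. *)

Lemma letterP (P : letter -> Prop) :
  P L1 -> P L2 -> P L3 -> forall a, P a.
Proof.
move=> p1 p2 p3 [[|[|[|//]]] h].
- by rewrite (_ : Ordinal h = L1) //; apply: val_inj.
- by rewrite (_ : Ordinal h = L2) //; apply: val_inj.
- by rewrite (_ : Ordinal h = L3) //; apply: val_inj.
Qed.

Lemma sum_letter (R : realType) (F : letter -> R) :
  \sum_(a < 3) F a = F L1 + F L2 + F L3.
Proof.
rewrite !big_ord_recr big_ord0 /= add0r.
by congr (_ + _ + _); congr F; apply: val_inj.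
Qed.

(** * Weights of words and incidence matrices *)

Lemma phi_cat (R : realType) (x : 'cV[R]_3) (v w : word) :
  phi x (v ++ w) = phi x v + phi x w.
Proof. by rewrite /phi !sum_letter !count_cat !natrD; ring. Qed.

Lemma phi_nil (R : realType) (x : 'cV[R]_3) : phi x [::] = 0.
Proof. by rewrite /phi sum_letter /= !mulr0 !addr0. Qed.

Lemma phi_cons (R : realType) (x : 'cV[R]_3) (a : letter) (w : word) :
  phi x (a :: w) = x a 0 + phi x w.
Proof.
rewrite -cat1s phi_cat; congr (_ + _).
by rewrite /phi sum_letter /=; elim/letterP: a => /=; ring.
Qed.

Lemma phi_nseq (R : realType) (x : 'cV[R]_3) (a : letter) (j : nat) :
  phi x (nseq j a) = x a 0 * j%:R.
Proof.
elim: j => [|j IH]; first by rewrite phi_nil mulr0.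
by rewrite /= phi_cons IH -natr1; ring.
Qed.

Lemma AmxT_mulE (R : realType) (m : nat) (x : 'cV[R]_3) :
  [/\ ((Amx R m)^T *m x) L1 0 = x L2 0,
      ((Amx R m)^T *m x) L2 0 = m.+1%:R * x L1 0 + x L3 0 &
      ((Amx R m)^T *m x) L3 0 = m%:R * x L1 0 + x L3 0].
Proof. by split; rewrite !mxE sum_letter !mxE /=; ring. Qed.

(** Column b of [Amx R m] counts the letters of Lambda_m(b), so substituting in the word amounts to
    applying the transpose to the weights. *)
Lemma phi_Lambda (R : realType) (m : nat) (x : 'cV[R]_3) (w : word) :
  phi x (Lambda m w) = phi ((Amx R m)^T *m x) w.
Proof.
elim: w => [|a w IH]; first by rewrite !phi_nil.
have -> : Lambda m (a :: w) = Lambda_letter m a ++ Lambda m w by [].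
rewrite phi_cat IH phi_cons; congr (_ + _).
have [e1 e2 e3] := AmxT_mulE m x.
elim/letterP: a; rewrite ?e1 ?e2 ?e3 /Lambda_letter /=
  ?phi_cons ?phi_nseq ?phi_nil; rewrite -?natr1; ring.
Qed.

Definition ellK (R : realType) (n : nat -> nat) (ell : 'cV[R]_3) (k : nat) :
  'cV[R]_3 := (AmxK R n k)^T *m ell.

Lemma AmxKS (R : realType) (n : nat -> nat) (k : nat) :
  AmxK R n k.+1 = AmxK R n k *m Amx R (n k.+1).
Proof. by rewrite /AmxK big_nat_recr. Qed.

Lemma ellK0 (R : realType) (n : nat -> nat) (ell : 'cV[R]_3) :
  ellK n ell 0 = ell.
Proof. by rewrite /ellK /AmxK big_geq // trmx1 mul1mx. Qed.

Lemma ellKS (R : realType) (n : nat -> nat) (ell : 'cV[R]_3) (k : nat) :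
  ellK n ell k.+1 = (Amx R (n k.+1))^T *m ellK n ell k.
Proof. by rewrite /ellK AmxKS trmx_mul mulmxA. Qed.

Lemma phi_LambdaK (R : realType) (n : nat -> nat) (ell : 'cV[R]_3)
  (k : nat) (w : word) :
  phi ell (LambdaK n k w) = phi (ellK n ell k) w.
Proof.
elim: k w => [|k IH] w; first by rewrite ellK0.
by rewrite /= IH phi_Lambda ellKS.
Qed.

Lemma Amx_unit (R : realType) (m : nat) : Amx R m \in unitmx.
Proof.
(* The determinant of [Amx R m] is -1; this is its inverse, with integer entries. *)
pose B : 'M[R]_3 := \matrix_(i < 3, j < 3)
  nth 0 (nth [::] [:: [:: 0; 1; 0]; [:: 1; 0; - m%:R];
                      [:: -1; 0; m.+1%:R]] i) j.
suff /mulmx1_unit[] : Amx R m *m B = 1%:M by [].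
apply/matrixP => i j; rewrite !mxE sum_letter !mxE /=.
elim/letterP: i; elim/letterP: j => /=; rewrite -?natr1; ring.
Qed.

Lemma AmxK_unit (R : realType) (n : nat -> nat) (k : nat) :
  AmxK R n k \in unitmx.
Proof.
elim: k => [|k IH]; first by rewrite /AmxK big_geq // unitmx1.
by rewrite AmxKS unitmx_mul IH Amx_unit.
Qed.

(** * The cone C_{-,-,+} and the weight vectors l^(k) *)

(** Solving A^T y = w gives y_1 = w_2 - w_3, y_2 = w_1 and y_3 = w_3 - m y_1, and the signs of w
    force those of y. *)
Lemma cone_mmp_invAmxT (R : realType) (m : nat) (w : 'cV[R]_3) :
  cone_mmp w -> cone_mmp ((invmx (Amx R m))^T *m w).
Proof.
set y := _ *m w; have [e1 e2 e3] := AmxT_mulE m y.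
have yw : (Amx R m)^T *m y = w.
  by rewrite /y mulmxA -trmx_mul mulVmx ?Amx_unit // trmx1 mul1mx.
rewrite yw -natr1 in e1 e2 e3; case=> w1 w2 w3.
have m0 : 0 <= m%:R :> R by [].
by split; rewrite -/y; nra.
Qed.

(** The first k factors cancel, leaving inverse transposes of the later matrices, each of which
    preserves the cone. The induction on d absorbs the last factor into w. *)
Lemma cone_mmp_invAmxKT (R : realType) (n : nat -> nat) (k d : nat)
  (w : 'cV[R]_3) :
  cone_mmp w ->
  cone_mmp ((AmxK R n k)^T *m ((invmx (AmxK R n (d + k)))^T *m w)).
Proof.
elim: d w => [|d IH] w cw.
  by rewrite add0n mulmxA -trmx_mul mulVmx ?AmxK_unit // trmx1 mul1mx.
have -> : invmx (AmxK R n (d.+1 + k)) =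
    invmx (Amx R (n (d + k).+1)) *m invmx (AmxK R n (d + k)).
  rewrite addSn AmxKS.
  set X := AmxK R n (d + k); set Y := Amx R _.
  have Xu : X \in unitmx := AmxK_unit R n _.
  have Yu : Y \in unitmx := Amx_unit R _.
  have XYu : X *m Y \in unitmx by rewrite unitmx_mul Xu.
  apply: (can_inj (mulKmx XYu)); rewrite mulmxV // -!mulmxA.
  by rewrite (mulmxA Y) mulmxV // mul1mx mulmxV.
by rewrite trmx_mul -mulmxA; apply: IH; exact: cone_mmp_invAmxT.
Qed.

(** The limit defining l is taken with w = l. Applying (A^(k))^T, which is continuous, to its terms
    of index at least k gives nonnegative multiples of vectors of the cone; only weak signs survive
    in the limit. *)
Lemma is_ell_closed_cone (R : realType) (n : nat -> nat) (ell : 'cV[R]_3)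
  (k : nat) :
  is_ell n ell ->
  [/\ ellK n ell k L1 0 <= 0, ellK n ell k L2 0 <= 0
    & 0 <= ellK n ell k L3 0].
Proof.
case=> cell _ /(_ _ cell); set u := (X in X @ _ --> _) => u_ell.
pose M := (AmxK R n k)^T.
have Mu (a : letter) : (fun j => (M *m u j) a 0) @ \oo --> ellK n ell k a 0.
  have -> : ellK n ell k a 0 =
      M a L1 * ell L1 0 + M a L2 * ell L2 0 + M a L3 * ell L3 0.
    by rewrite /ellK mxE sum_letter.
  have -> : (fun j => (M *m u j) a 0) =
      (fun j => M a L1 * u j L1 0 + M a L2 * u j L2 0 + M a L3 * u j L3 0).
    by apply/funext => j; rewrite mxE sum_letter.
  have cu b : (fun j => M a b * u j b 0) @ \oo --> M a b * ell b 0.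
    apply: cvgM; first exact: cvg_cst.
    apply: (cvg_comp u (fun N : 'cV[R]_3 => N b 0) u_ell).
    exact: coord_continuous.
  by apply: cvgD; [apply: cvgD|].
have [r [r0 rE]] : exists r : nat -> R, (forall j, 0 <= r j) /\ forall d,
    M *m u (d + k)%N = r d *:
      (M *m ((invmx (AmxK R n (d + k)))^T *m ell)).
  exists (fun d => (norm2 ((invmx (AmxK R n (d + k)))^T *m ell))^-1).
  split=> [j|d]; first by rewrite invr_ge0 sqrtr_ge0.
  by rewrite /u -scalemxAr.
have near_shift (P : nat -> Prop) :
    (forall d, P (d + k)%N) -> \forall j \near \oo, P j.
  by move=> HP; exists k => // j /= kj; rewrite -(subnK kj); exact: HP.
split.
- apply: (@cvgr_to_le _ _ _ _ _ _ _ (Mu L1)); apply: near_shift => d.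
  have [c1 _ _] := cone_mmp_invAmxKT n k d cell.
  by rewrite rE mxE; apply: mulr_ge0_le0 => //; exact: ltW.
- apply: (@cvgr_to_le _ _ _ _ _ _ _ (Mu L2)); apply: near_shift => d.
  have [_ c2 _] := cone_mmp_invAmxKT n k d cell.
  by rewrite rE mxE; apply: mulr_ge0_le0 => //; exact: ltW.
- apply: (@cvgr_to_ge _ _ _ _ _ _ _ (Mu L3)); apply: near_shift => d.
  have [_ _ c3] := cone_mmp_invAmxKT n k d cell.
  by rewrite rE mxE; apply: mulr_ge0 => //; exact: ltW.
Qed.

(* A vanishing coordinate of l^(k+1) would propagate to l^(k+2), l^(k+3), ... *)
(* and force a sign contradiction with the closed cone.                       *)
Lemma ellK_cone (R : realType) (n : nat -> nat) (ell : 'cV[R]_3) (k : nat) :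
  (forall i, (1 <= i)%N -> (1 <= n i)%N) ->
  is_ell n ell -> cone_mmp (ellK n ell k).
Proof.
move=> n_pos ell_def; elim: k => [|k]; first by rewrite ellK0; case: ell_def.
have step j : exists N : R, [/\ 1 <= N,
    ellK n ell j.+1 L1 0 = ellK n ell j L2 0,
    ellK n ell j.+1 L2 0 = N * ellK n ell j L1 0 + ellK n ell j L1 0
                             + ellK n ell j L3 0 &
    ellK n ell j.+1 L3 0 = N * ellK n ell j L1 0 + ellK n ell j L3 0].
  exists (n j.+1)%:R; have [e1 e2 e3] := AmxT_mulE (n j.+1) (ellK n ell j).
  by rewrite ellKS e1 e2 e3 ler1n n_pos // -natr1; split => //; ring.
have [N0 [hN0 e1 e2 e3]] := step k.
have [N1 [hN1 f1 f2 f3]] := step k.+1.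
have [N2 [hN2 g1 g2 g3]] := step k.+2.
have [N3 [hN3 h1 h2 h3]] := step k.+3.
move=> [x1 x2 x3].
have [y1 y2 y3] := is_ell_closed_cone k.+1 ell_def.
have [z1 z2 z3] := is_ell_closed_cone k.+2 ell_def.
have [w1 w2 w3] := is_ell_closed_cone k.+3 ell_def.
have [v1 v2 v3] := is_ell_closed_cone k.+4 ell_def.
split.
- by rewrite e1.
- rewrite lt_neqAle y2 andbT; apply/eqP => y20.
  (* Now l^(k+3)_2 = l^(k+3)_3 = l^(k+2)_3, and the opposite weak signs make this 0. Then l^(k+4)_3
     is a positive multiple of l^(k+3)_1, so l^(k+3)_1 = 0, whereas the recursion gives l^(k+3)_1 =
     l^(k+2)_2 = l^(k+1)_1 = l^(k)_2 < 0. *)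
  have z10 : ellK n ell k.+2 L1 0 = 0 by rewrite f1.
  rewrite z10 mulr0 !add0r in g2 g3.
  have z30 : ellK n ell k.+2 L3 0 = 0 by apply/eqP; rewrite eq_le; lra.
  have w10 : ellK n ell k.+3 L1 0 = 0.
    by apply/eqP; rewrite eq_le; apply/andP; split; nra.
  lra.
(* Otherwise l^(k+2)_3 would be a positive multiple of l^(k+1)_1 = l^(k)_2 < 0. *)
- by rewrite lt_neqAle y3 andbT; apply/eqP => y30; nra.
Qed.

(** * Edges of the substitutions and their slack *)

(** The complete list of edges (u, a, v) leading to b; j counts the letters 1 of the block that
    precede the marked one. *)
Variant Lambda_split (m : nat) : letter -> word * letter * word -> Prop :=
| Split1 : Lambda_split m L1 ([::], L2, [::])
| Split2_head : Lambda_split m L2 ([::], L3, nseq m.+1 L1)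
| Split2_tail j of (j <= m)%N :
    Lambda_split m L2 (L3 :: nseq j L1, L1, nseq (m - j) L1)
| Split3_head : Lambda_split m L3 ([::], L3, nseq m L1)
| Split3_tail j of (j < m)%N :
    Lambda_split m L3 (L3 :: nseq j L1, L1, nseq (m - j.+1) L1).

Lemma nseq_eq_cat (T : Type) (c a : T) (q : nat) (u v : seq T) :
  nseq q c = u ++ a :: v ->
  exists2 j, (j < q)%N & [/\ u = nseq j c, a = c & v = nseq (q - j.+1) c].
Proof.
elim: q u => [|q IH] [|b u] //= [].
  by move=> <- <-; exists 0%N; rewrite ?subn1.
by move=> <- /IH[j jq [-> -> ->]]; exists j.+1; rewrite ?subSS.
Qed.

Lemma Lambda_splitP (m : nat) (b : letter) (e : word * letter * word) :
  Lambda_letter m b = e.1.1 ++ e.1.2 :: e.2 -> Lambda_split m b e.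
Proof.
case: e => [[u a] v] /=.
elim/letterP: b; rewrite /Lambda_letter [val _]/=.
- by case: u => [|c [|d u]] //= [<- <-]; exact: Split1.
- case: u => [|c u] [<-]; first by move=> <-; exact: Split2_head.
  move=> E; have [j] := @nseq_eq_cat _ L1 a m.+1 u v E.
  rewrite ltnS => jm [-> -> ->].
  by rewrite subSS; exact: Split2_tail.
- case: u => [|c u] [<-]; first by move=> <-; exact: Split3_head.
  move=> E; have [j jm [-> -> ->]] := @nseq_eq_cat _ L1 a m u v E.
  exact: Split3_tail.
Qed.

(* [lo x a] and [hi x a] are the end points of the interval [J_a], at the     *)
(* level where the vector of letter weights is [x].                           *)
Definition lo (R : realType) (x : 'cV[R]_3) (a : letter) : R :=
  nth 0 [:: - x L1 0; - x L2 0; 0] a.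

Definition hi (R : realType) (x : 'cV[R]_3) (a : letter) : R :=
  nth 0 [:: x L3 0 - x L2 0; - x L1 0; - x L2 0] a.

(** For each a, the letter b that the unique edge at a tight for [lo] leads to; [hi_next] is its
    analogue for [hi]. *)
Definition lo_next (a : letter) : letter := nth L3 [:: L2; L1; L3] a.
Definition hi_next (a : letter) : letter := nth L3 [:: L2; L1; L2] a.

(** The list covers the letters 1 and 2 only: the default of [nth] is the edge for the letter 3,
    here and in [hi_edge]. *)
Definition lo_edge (m : nat) (a : letter) : word * letter * word :=
  nth ([::], L3, nseq m L1)
    [:: (L3 :: nseq m L1, L1, [::]); ([::], L2, [::])] a.

Definition hi_edge (m : nat) (a : letter) : word * letter * word :=
  nth ([::], L3, nseq m.+1 L1)
    [:: ([:: L3], L1, nseq m L1); ([::], L2, [::])] a.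

Lemma lo_edge_split (m : nat) (a : letter) :
  (lo_edge m a).1.2 = a /\
  Lambda_letter m (lo_next a) =
    (lo_edge m a).1.1 ++ (lo_edge m a).1.2 :: (lo_edge m a).2.
Proof.
by elim/letterP: a; split=> //; rewrite /= -(nseqD m 1) addn1.
Qed.

Lemma hi_edge_split (m : nat) (a : letter) :
  (hi_edge m a).1.2 = a /\
  Lambda_letter m (hi_next a) =
    (hi_edge m a).1.1 ++ (hi_edge m a).1.2 :: (hi_edge m a).2.
Proof. by elim/letterP: a. Qed.

Lemma lo_edge_tight (R : realType) (m : nat) (x : 'cV[R]_3) (a : letter) :
  phi x (lo_edge m a).1.1 + lo ((Amx R m)^T *m x) (lo_next a) = lo x a.
Proof.
have [e1 e2 e3] := AmxT_mulE m x.
elim/letterP: a; rewrite /lo /= ?e1 ?e2 ?e3 ?phi_cons ?phi_nil ?phi_nseq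
  -?natr1; ring.
Qed.

Lemma hi_edge_tight (R : realType) (m : nat) (x : 'cV[R]_3) (a : letter) :
  phi x (hi_edge m a).1.1 + hi ((Amx R m)^T *m x) (hi_next a) = hi x a.
Proof.
have [e1 e2 e3] := AmxT_mulE m x.
elim/letterP: a; rewrite /hi /= ?e1 ?e2 ?e3 ?phi_cons ?phi_nil ?phi_nseq
  -?natr1; ring.
Qed.

(** Put y = A^T x. In [Split2_tail] the slack is -(m - j) x_1 for [lo] and -j x_1 for [hi], so it
    vanishes only at j = m and at j = 0 respectively. In the other cases it is 0 on the tight edges
    and otherwise -y_2, y_2 - y_1, y_3 - (m - j - 1) x_1 or y_2 - y_1 - j x_1, all positive. Also
    x_3 + j x_1 >= y_3 > 0 for j <= m, whence the sign of the weight of u. *)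
Lemma Lambda_split_bounds (R : realType) (m : nat) (x : 'cV[R]_3)
  (b : letter) (e : word * letter * word) :
  (1 <= m)%N -> cone_mmp x -> cone_mmp ((Amx R m)^T *m x) ->
  ((Amx R m)^T *m x) L1 0 < ((Amx R m)^T *m x) L2 0 ->
  Lambda_split m b e ->
  [/\ 0 <= phi x e.1.1,
      lo x e.1.2 <= phi x e.1.1 + lo ((Amx R m)^T *m x) b,
      phi x e.1.1 + hi ((Amx R m)^T *m x) b <= hi x e.1.2,
      phi x e.1.1 + lo ((Amx R m)^T *m x) b = lo x e.1.2 ->
        e = lo_edge m e.1.2 /\ b = lo_next e.1.2 &
      phi x e.1.1 + hi ((Amx R m)^T *m x) b = hi x e.1.2 ->
        e = hi_edge m e.1.2 /\ b = hi_next e.1.2].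
Proof.
move=> m1 [x1 x2 x3]; have [e1 e2 e3] := AmxT_mulE m x.
rewrite /cone_mmp /= e1 e2 e3 => -[y1 y2 y3] y12.
have M1 : 1 <= m%:R :> R by rewrite ler1n.
have pJ j : phi x (L3 :: nseq j L1) = x L3 0 + j%:R * x L1 0.
  by rewrite phi_cons phi_nseq mulrC.
case=> [||j jm||j jm]; rewrite /lo /hi /= ?e1 ?e2 ?e3 ?phi_nil ?pJ;
  rewrite -natr1 in y2 y12 *.
- by split=> [|||_|_]; [lra|lra|lra|split|split].
- by split=> [|||E|_]; [lra|lra|lra|exfalso; lra|split].
- have mE : m%:R = j%:R + (m - j)%:R :> R by rewrite -natrD subnKC.
  have j0 : 0 <= j%:R :> R by [].
  have d0 : 0 <= (m - j)%:R :> R by [].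
  rewrite mE in y2 y3 y12 *; split=> [|||E|E]; [nra|nra|nra| |].
  + suff -> : j = m by rewrite subnn.
    apply/eqP; rewrite eqn_leq jm leqNgt; apply/negP => jlt.
    have : 1 <= (m - j)%:R :> R by rewrite ler1n subn_gt0.
    nra.
  + have [->|j_gt0] := posnP j; first by rewrite subn0.
    have J1 : 1 <= j%:R :> R by rewrite ler1n.
    by exfalso; nra.
- by split=> [|||_|E]; [lra|lra|lra|split|exfalso; lra].
- have mE : m%:R = j%:R + (m - j.+1)%:R + 1 :> R.
    by rewrite addrAC natr1 -natrD subnKC.
  have j0 : 0 <= j%:R :> R by [].
  have d0 : 0 <= (m - j.+1)%:R :> R by [].
  rewrite mE in y2 y3 y12 *; split=> [|||E|E]; [| | |exfalso|exfalso]; nra.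
Qed.

(** * Telescoping and convergence of sequences *)

(** The slacks t_i + p_(i+1) - p_i are nonnegative and sum to P - p_0, because p tends to 0; such a
    sum is zero only if every term is. *)
Lemma potential_bound (R : realType) (t p : nat -> R) (P : R) :
  (fun N => \sum_(0 <= i < N) t i) @ \oo --> P -> p @ \oo --> 0 ->
  (forall i, p i <= t i + p i.+1) ->
  p 0%N <= P /\ (P = p 0%N <-> forall i, t i + p i.+1 = p i).
Proof.
move=> tP p0 pt.
pose s i := t i + p i.+1 - p i.
have s_ge0 i : 0 <= s i by rewrite subr_ge0.
have sE N : \sum_(0 <= i < N) s i = \sum_(0 <= i < N) t i + p N - p 0%N.
  elim: N => [|N IH]; first by rewrite !big_geq // add0r subrr.
  by rewrite !big_nat_recr //= IH /s; ring.
have sP : (fun N => \sum_(0 <= i < N) s i) @ \oo --> P - p 0%N.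
  under eq_fun do rewrite sE.
  rewrite -[X in X - _]addr0; apply: cvgB; last exact: cvg_cst.
  exact: cvgD.
have s_le i : s i <= P - p 0%N.
  apply: (cvgr_to_ge sP); exists i.+1 => // N /= iN.
  rewrite big_mkord (bigD1 (Ordinal iN)) //= lerDl; exact: sumr_ge0.
split; first by rewrite -subr_ge0; exact: le_trans (s_le 0%N).
split=> [Pp i|tight].
  apply/eqP; rewrite -subr_eq0 eq_le s_ge0 andbT.
  by rewrite (le_trans (s_le i)) // Pp subrr.
apply/eqP; rewrite -subr_eq0; apply/eqP.
apply: (cvg_unique _ sP) => //.
have -> : (fun N => \sum_(0 <= i < N) s i) = fun=> 0; last exact: cvg_cst.
by apply/funext => N; rewrite big1 // => i _; rewrite /s tight subrr.
Qed.

(** The sequence decreases to some L >= 0, and the inequality gives 2L <= L in the limit. *)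
Lemma cvg0_of_fib_le (R : realType) (a : nat -> R) :
  (forall k, 0 <= a k) -> (forall k, a k.+1 + a k.+2 <= a k) ->
  a @ \oo --> 0.
Proof.
move=> a_ge0 fib.
have a_cvg : cvgn a.
  apply: nonincreasing_is_cvgn; last by exists 0 => _ [k _ <-].
  apply/nonincreasing_seqP => k.
  by apply: le_trans (fib k); rewrite lerDl.
have a_lim : a @ \oo --> limn a by [].
suff <- : limn a = 0 by [].
have a1 : (fun k => a k.+1) @ \oo --> limn a.
  by have := a_lim; rewrite -cvg_shiftS.
have a2 : (fun k => a k.+2) @ \oo --> limn a.
  by have := a1; rewrite -[X in X -> _]cvg_shiftS.
have ge0 : 0 <= limn a by apply: (cvgr_to_ge a_lim); exact: nearW.
have : limn a + limn a <= limn a.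
  by apply: (ler_cvg_to (cvgD a1 a2) a_lim); exact: nearW.
lra.
Qed.

Lemma cvg_opp0 (R : realType) (f : nat -> R) :
  f @ \oo --> 0 -> (fun k => - f k) @ \oo --> 0.
Proof. by move=> /cvgN; rewrite oppr0. Qed.

(** Every edge is the prescribed one, for instance the tight one. Since [next] sees only the current
    letter, the first letter fixes the whole path. *)
Definition follows (edge : nat -> letter -> word * letter * word)
    (next : letter -> letter) (n : nat -> nat) (G : edge_path) : Prop :=
  forall i, G i = edge (n i.+1) (path_a G i) /\
            path_a G i.+1 = next (path_a G i).

Lemma follows_inj edge next (n : nat -> nat) (G H : edge_path) :
  follows edge next n G -> follows edge next n H ->
  path_a G 0 = path_a H 0 -> G = H.
Proof.
move=> FG FH GH0.
have GH i : path_a G i = path_a H i.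
  by elim: i => // i IH; have [_ ->] := FG i; have [_ ->] := FH i; rewrite IH.
by apply/funext => i; have [-> _] := FG i; have [-> _] := FH i; rewrite GH.
Qed.

(** * Bounds for Psi_L and the paths that attain them *)

Section Bounds.
Variables (R : realType) (n : nat -> nat) (ell : 'cV[R]_3).
Hypothesis n_pos : forall i : nat, (1 <= i)%N -> (1 <= n i)%N.
Hypothesis ell_def : is_ell n ell.

Let x (k : nat) : 'cV[R]_3 := ellK n ell k.

(** The second and third coordinates of l^(k+1) differ by l^(k)_1, which gives the second identity.
    The inequality reduces to l^(k+1)_1 + l^(k+1)_3 > 0, which follows from l^(k+2)_3 > 0 since
    n_(k+2) >= 1 and l^(k+1)_1 < 0. *)
Lemma ellK_rec (k : nat) :
  [/\ x k L2 0 = x k.+1 L1 0,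
      x k L1 0 = x k.+2 L1 0 - x k.+1 L3 0 &
      x k.+1 L1 0 + x k.+2 L1 0 > x k L1 0].
Proof.
have [_ _ c1] := ellK_cone k.+1 n_pos ell_def.
have [p1 _ _] := ellK_cone k n_pos ell_def.
have [q1 _ c2] := ellK_cone k.+2 n_pos ell_def.
have [q0 _ _] := ellK_cone k.+1 n_pos ell_def.
have N1 : 1 <= (n k.+2)%:R :> R by rewrite ler1n n_pos.
have [e1 e2 e3] := AmxT_mulE (n k.+1) (x k).
have [f1 f2 f3] := AmxT_mulE (n k.+2) (x k.+1).
rewrite -natr1 /x -!ellKS in e1 e2 e3 f1 f2 f3 *.
by split; nra.
Qed.

Lemma ellK_lt (k : nat) : x k L1 0 < x k L2 0.
Proof.
have [e1 e2 e3] := ellK_rec k.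
by have [c1 _ _] := ellK_cone k.+2 n_pos ell_def; rewrite e1 /x in e3 *; lra.
Qed.

(** The first coordinate tends to 0 by [cvg0_of_fib_le]; by [ellK_rec] the other two are expressed
    through its shifts. *)
Lemma ellK_cvg0 (a : letter) : (fun k => x k a 0) @ \oo --> 0.
Proof.
have x1 : (fun k => x k L1 0) @ \oo --> 0.
  have nx1 : (fun k => - x k L1 0) @ \oo --> 0.
    apply: cvg0_of_fib_le => k.
      by have [c _ _] := ellK_cone k n_pos ell_def; rewrite oppr_ge0 ltW.
    by have [_ _ e] := ellK_rec k; lra.
  have xE : - (fun k => - x k L1 0) = (fun k => x k L1 0).
    by apply/funext => k; rewrite fctE opprK.
  by have := cvgN nx1; rewrite oppr0 xE; apply.
have x1S : (fun k => x k.+1 L1 0) @ \oo --> 0.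
  by have := x1; rewrite -cvg_shiftS.
have x1SS : (fun k => x k.+2 L1 0) @ \oo --> 0.
  by have := x1S; rewrite -[X in X -> _]cvg_shiftS.
elim/letterP: a => //.
  by under eq_fun do rewrite (let: And3 e _ _ := ellK_rec _ in e).
rewrite -cvg_shiftS /=.
have -> : (fun k => x k.+1 L3 0) = (fun k => x k.+2 L1 0 - x k L1 0).
  by apply/funext => k; have [_ -> _] := ellK_rec k; ring.
by have := cvgB x1SS x1; rewrite subr0; apply.
Qed.

(** The letter may change with k, so all end points are squeezed at once between 0 and x_3 - x_2 -
    x_1. *)
Lemma lo_hi_cvg0 (a : nat -> letter) :
  (fun k => lo (x k) (a k)) @ \oo --> 0 /\
  (fun k => hi (x k) (a k)) @ \oo --> 0.
Proof.
have S0 : (fun k => x k L3 0 - x k L2 0 - x k L1 0) @ \oo --> 0.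
  have := cvgB (cvgB (ellK_cvg0 L3) (ellK_cvg0 L2)) (ellK_cvg0 L1).
  by rewrite !subr0; apply.
split; apply: (squeeze_cvgr _ (cvg_cst 0) S0); apply: nearW => k;
  have [] := ellK_cone k n_pos ell_def; rewrite -/(x k);
  by elim/letterP: (a k) => /= *; rewrite /lo /hi /=; lra.
Qed.

Lemma path_step (G : edge_path) (i : nat) :
  paths n G ->
  [/\ 0 <= phi (x i) (path_u G i),
      lo (x i) (path_a G i) <=
        phi (x i) (path_u G i) + lo (x i.+1) (path_a G i.+1),
      phi (x i) (path_u G i) + hi (x i.+1) (path_a G i.+1) <=
        hi (x i) (path_a G i),
      phi (x i) (path_u G i) + lo (x i.+1) (path_a G i.+1) =
        lo (x i) (path_a G i) ->
        G i = lo_edge (n i.+1) (path_a G i) /\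
        path_a G i.+1 = lo_next (path_a G i) &
      phi (x i) (path_u G i) + hi (x i.+1) (path_a G i.+1) =
        hi (x i) (path_a G i) ->
        G i = hi_edge (n i.+1) (path_a G i) /\
        path_a G i.+1 = hi_next (path_a G i)].
Proof.
move=> /(_ i) /Lambda_splitP Gi; rewrite /x ellKS.
apply: Lambda_split_bounds => //; rewrite -?ellKS.
- exact: n_pos.
- exact: ellK_cone.
- exact: ellK_cone.
- exact: ellK_lt.
Qed.

(** [limn] is informative only once convergence is known: the terms are nonnegative, and the [hi]
    inequalities bound the partial sums by the upper end point. The term of index 0, separate in
    [PsiL], is merged into the series. *)
Lemma PsiL_cvg (G : edge_path) :
  paths n G ->
  (fun N => \sum_(0 <= i < N) phi (x i) (path_u G i)) @ \oo --> PsiL n ell G.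
Proof.
move=> pG; pose t i := phi (x i) (path_u G i).
have t_ge0 i : 0 <= t i by have [] := path_step i pG.
have t_bound N :
    \sum_(0 <= i < N) t i + hi (x N) (path_a G N) <= hi (x 0) (path_a G 0).
  elim: N => [|N IH]; first by rewrite big_geq // add0r.
  rewrite big_nat_recr //= -addrA; apply: le_trans IH; rewrite lerD2l.
  by have [] := path_step N pG.
have hi_ge0 k a : 0 <= hi (x k) a.
  have [] := ellK_cone k n_pos ell_def; rewrite -/(x k).
  by elim/letterP: a => /= *; rewrite /hi /=; lra.
have t_cvg : cvgn (fun N => \sum_(0 <= i < N) t i).
  apply: nondecreasing_is_cvgn.
    apply/nondecreasing_seqP => N.
    by rewrite big_nat_recr //= lerDl.
  exists (hi (x 0) (path_a G 0)) => _ [N _ <-].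
  by apply: le_trans (t_bound N); rewrite lerDl.
have PsiE : PsiL n ell G = t 0%N + limn (fun N => \sum_(1 <= i < N) t i).
  rewrite /PsiL /t /x ellK0; congr (_ + limn _); apply/funext => N.
  by apply: eq_bigr => i _; rewrite phi_LambdaK.
have sumE N : \sum_(1 <= i < N.+1) t i = \sum_(0 <= i < N.+1) t i - t 0%N.
  by rewrite [in RHS]big_ltn // addrC addKr.
have : (fun N => \sum_(1 <= i < N) t i) @ \oo -->
    limn (fun N => \sum_(0 <= i < N) t i) - t 0%N.
  rewrite -cvg_shiftS; under eq_fun do rewrite /= sumE.
  apply: cvgB; last exact: cvg_cst.
  have : (fun N => \sum_(0 <= i < N) t i) @ \oo -->
    limn (fun N => \sum_(0 <= i < N) t i) by [].
  by rewrite -[X in X -> _]cvg_shiftS.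
move=> /(cvg_lim (@Rhausdorff R)) E.
by rewrite PsiE E addrC subrK.
Qed.

Lemma PsiL_cvg_opp (G : edge_path) :
  paths n G ->
  (fun N => \sum_(0 <= i < N) - phi (x i) (path_u G i)) @ \oo -->
  - PsiL n ell G.
Proof.
move=> pG.
have -> : (fun N => \sum_(0 <= i < N) - phi (x i) (path_u G i)) =
    - (fun N => \sum_(0 <= i < N) phi (x i) (path_u G i)).
  by apply/funext => N; rewrite sumrN.
by apply: cvgN; exact: PsiL_cvg.
Qed.

Lemma PsiL_lo (G : edge_path) :
  paths n G ->
  lo ell (path_a G 0) <= PsiL n ell G /\
  (PsiL n ell G = lo ell (path_a G 0) ->
     follows lo_edge lo_next n G).
Proof.
move=> pG; have [lo0 _] := lo_hi_cvg0 (path_a G).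
have [] := potential_bound (PsiL_cvg pG) lo0.
  by move=> i; have [] := path_step i pG.
rewrite /x ellK0 => -> [tight _]; split=> // /tight ti i.
by have [_ _ _ + _] := path_step i pG; apply; exact: ti.
Qed.

(** The upper bound is the lower bound of [potential_bound] for the negated weights and the
    potential -[hi]. *)
Lemma PsiL_hi (G : edge_path) :
  paths n G ->
  PsiL n ell G <= hi ell (path_a G 0) /\
  (PsiL n ell G = hi ell (path_a G 0) ->
     follows hi_edge hi_next n G).
Proof.
move=> pG; have [_ hi0] := lo_hi_cvg0 (path_a G).
have [] := potential_bound (PsiL_cvg_opp pG) (cvg_opp0 hi0).
  by move=> i; rewrite -opprD lerN2; have [] := path_step i pG.
rewrite /x ellK0 lerN2 => -> [tight _]; split=> // Ehi i.
have {}tight := tight (congr1 -%R Ehi) i.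
have [_ _ _ _] := path_step i pG; apply.
by apply: oppr_inj; rewrite opprD; exact: tight.
Qed.

(** The converse of the equality case in [PsiL_lo]: when all slacks vanish, the telescoped
    inequality is an equality. *)
Lemma follows_lo_PsiL (G : edge_path) :
  follows lo_edge lo_next n G ->
  paths n G /\ PsiL n ell G = lo ell (path_a G 0).
Proof.
move=> GE.
have pG : paths n G.
  move=> i; have [Gi ->] := GE i.
  have [aE ->] := lo_edge_split (n i.+1) (path_a G i).
  by rewrite aE /path_u /path_v Gi.
split=> //; have [lo0 _] := lo_hi_cvg0 (path_a G).
have [|_ [_ H]] := potential_bound (PsiL_cvg pG) lo0.
  by move=> i; have [] := path_step i pG.
rewrite H /x ?ellK0 // => i; have [Gi ->] := GE i.
by rewrite {1}/path_u Gi ellKS lo_edge_tight.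
Qed.

Lemma follows_hi_PsiL (G : edge_path) :
  follows hi_edge hi_next n G ->
  paths n G /\ PsiL n ell G = hi ell (path_a G 0).
Proof.
move=> GE.
have pG : paths n G.
  move=> i; have [Gi ->] := GE i.
  have [aE ->] := hi_edge_split (n i.+1) (path_a G i).
  by rewrite aE /path_u /path_v Gi.
split=> //; have [_ hi0] := lo_hi_cvg0 (path_a G).
have [|_ [_ H]] := potential_bound (PsiL_cvg_opp pG) (cvg_opp0 hi0).
  by move=> i; rewrite -opprD lerN2; have [] := path_step i pG.
apply: oppr_inj; rewrite H /x ?ellK0 // => i; have [Gi ->] := GE i.
by rewrite {1}/path_u Gi ellKS -opprD hi_edge_tight.
Qed.

End Bounds.

(** * The six special paths consist of tight edges *)

Lemma Gmin_follows (n : nat -> nat) : follows lo_edge lo_next n (Gmin n).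
Proof. by []. Qed.

Lemma G2min_follows (n : nat -> nat) : follows lo_edge lo_next n (G2min n).
Proof. by move=> i; rewrite /path_a /G2min /=; case: (odd i). Qed.

Lemma G1min_follows (n : nat -> nat) : follows lo_edge lo_next n (G1min n).
Proof. by move=> i; rewrite /path_a /G1min /=; case: (odd i). Qed.

Lemma G3max_follows (n : nat -> nat) : follows hi_edge hi_next n (G3max n).
Proof. by case=> [|i] //; rewrite /path_a /G3max /=; case: (odd i). Qed.

Lemma G2max_follows (n : nat -> nat) : follows hi_edge hi_next n (G2max n).
Proof. by move=> i; rewrite /path_a /G2max /=; case: (odd i). Qed.

Lemma Gmax_follows (n : nat -> nat) : follows hi_edge hi_next n (Gmax n).
Proof. by move=> i; rewrite /path_a /Gmax /=; case: (odd i). Qed.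

Theorem theorem9p1 (R : realType) (n : nat -> nat)
  (n_pos : forall i : nat, (1 <= i)%N -> (1 <= n i)%N)
  (ell : 'cV[R]_3) (ell_def : is_ell n ell) :
  let Psi : edge_path -> R := PsiL n ell in
  let piece : letter -> set R := rauzy_piece n ell in
  (exists J : letter -> interval R,
     (forall a : letter, piece a `<=` [set` J a]) /\
     (forall a b : letter, a <> b ->
        is_subset1 ([set` J a] `&` [set` J b]))) /\
  (0 = Psi (Gmin n) /\
   (forall x : R, piece L3 x -> Psi (Gmin n) <= x /\ x <= Psi (G3max n)) /\
   Psi (G3max n) = - ell L2 0 /\ - ell L2 0 = Psi (G2min n) /\
   (forall x : R, piece L2 x -> Psi (G2min n) <= x /\ x <= Psi (G2max n)) /\
   Psi (G2max n) = - ell L1 0 /\ - ell L1 0 = Psi (G1min n) /\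
   (forall x : R, piece L1 x -> Psi (G1min n) <= x /\ x <= Psi (Gmax n)) /\
   Psi (Gmax n) = ell L3 0 - ell L2 0) /\
  (paths n `&` Psi @^-1` [set 0] = [set Gmin n] /\
   paths n `&` Psi @^-1` (piece L3 `&` piece L2) = [set G3max n; G2min n] /\
   paths n `&` Psi @^-1` (piece L2 `&` piece L1) = [set G2max n; G1min n] /\
   paths n `&` Psi @^-1` [set ell L3 0 - ell L2 0] = [set Gmax n]).
Proof.
move=> Psi piece.
have c0 := ellK_cone 0 n_pos ell_def.
have c1 := ellK_cone 1 n_pos ell_def.
have l12 := ellK_lt n_pos ell_def 0.
(* This keeps the top value l_3 - l_2 strictly above -l_1, the maximum over the second piece. *)
have l13 : 0 < ell L1 0 + ell L3 0.
  have [_ _] := c1; rewrite ellKS ellK0.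
  have [_ _ ->] := AmxT_mulE (n 1%N) ell.
  have N1 : 1 <= (n 1%N)%:R :> R by rewrite ler1n n_pos.
  by move: c0; rewrite ellK0 => -[? ? ?] ?; nra.
rewrite ellK0 in c0 l12; have {c0 c1} [l1 l2 l3] := c0.
have loP G (pG : paths n G) := PsiL_lo n_pos ell_def pG.
have hiP G (pG : paths n G) := PsiL_hi n_pos ell_def pG.
have lo_uniq G H : paths n G -> follows lo_edge lo_next n H ->
    path_a G 0 = path_a H 0 -> Psi G = lo ell (path_a G 0) -> G = H.
  by move=> /loP[_ fG] fH GH /fG {}fG; exact: follows_inj fG fH GH.
have hi_uniq G H : paths n G -> follows hi_edge hi_next n H ->
    path_a G 0 = path_a H 0 -> Psi G = hi ell (path_a G 0) -> G = H.
  by move=> /hiP[_ fG] fH GH /fG {}fG; exact: follows_inj fG fH GH.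
have [pmin Emin] := follows_lo_PsiL n_pos ell_def (Gmin_follows n).
have [p2min E2min] := follows_lo_PsiL n_pos ell_def (G2min_follows n).
have [p1min E1min] := follows_lo_PsiL n_pos ell_def (G1min_follows n).
have [p3max E3max] := follows_hi_PsiL n_pos ell_def (G3max_follows n).
have [p2max E2max] := follows_hi_PsiL n_pos ell_def (G2max_follows n).
have [pmax Emax] := follows_hi_PsiL n_pos ell_def (Gmax_follows n).
rewrite -/Psi /= in Emin E2min E1min E3max E2max Emax.
have pieceP a y : piece a y -> lo ell a <= y <= hi ell a.
  by move=> [G [pG <-] <-]; rewrite (loP G pG).1 (hiP G pG).1.
have pieceI G : paths n G -> piece (path_a G 0) (Psi G) by exists G.
have letter3 (a : letter) : [\/ a = L1, a = L2 | a = L3].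
  by elim/letterP: a; [constructor 1|constructor 2|constructor 3].
split.
  exists (fun a => `[lo ell a, hi ell a]); split=> [a y /pieceP|a b].
    by rewrite /= in_itv.
  have [->|->|->] := letter3 a; have [->|->|->] := letter3 b; move=> ab y z;
    (try by case: ab); rewrite /= !in_itv /lo /hi /=;
    move=> [/andP[? ?] /andP[? ?]] [/andP[? ?] /andP[? ?]]; lra.
split.
  rewrite Emin E2min E1min E3max E2max Emax /lo /hi /=.
  have range a y : piece a y -> lo ell a <= y /\ y <= hi ell a.
    by move=> /pieceP/andP.
  split=> //; split; first exact: (range L3).
  split=> //; split=> //; split; first exact: (range L2).
  by split=> //; split=> //; split; first exact: (range L1).
have bounds G : paths n G ->
    lo ell (path_a G 0) <= Psi G <= hi ell (path_a G 0).
  by move=> /pieceI/pieceP.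
split; [|split; [|split]]; apply/seteqP; split=> [G [pG /=]|G].
- move=> PG; have := bounds _ pG; rewrite PG.
  have [aE|aE|aE] := letter3 (path_a G 0); rewrite aE /lo /hi /= => /andP[? ?].
  + by exfalso; lra.
  + by exfalso; lra.
  + by apply: (lo_uniq _ _ pG (Gmin_follows n)); rewrite aE ?PG.
- by move=> ->; split=> //=; rewrite Emin.
(* The value is at most the top of J_3 and at least the bottom of J_2, both equal to -l_2. The first
   letter cannot be 1, as -l_1 > -l_2; the letter 2 makes the path minimal and the letter 3 makes it
   maximal in its piece. *)
- move=> [/pieceP/andP[_ PG_hi] /pieceP/andP[PG_lo _]].
  have PG : Psi G = - ell L2 0 by apply/le_anti/andP; split.
  have := bounds _ pG; rewrite PG.
  have [aE|aE|aE] := letter3 (path_a G 0); rewrite aE /lo /hi /= => /andP[? ?].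
  + by exfalso; lra.
  + by right; apply: (lo_uniq _ _ pG (G2min_follows n)); rewrite aE ?PG.
  + by left; apply: (hi_uniq _ _ pG (G3max_follows n)); rewrite aE ?PG.
(* The two paths have the same value but different first letters, so this value lies in both
   pieces. *)
- have E : Psi (G3max n) = Psi (G2min n) by rewrite E3max E2min.
  case=> ->; split=> //=.
  + by split; [exact: pieceI p3max|rewrite E; exact: pieceI p2min].
  + by split; [rewrite -E; exact: pieceI p3max|exact: pieceI p2min].
- move=> [/pieceP/andP[_ PG_hi] /pieceP/andP[PG_lo _]].
  have PG : Psi G = - ell L1 0 by apply/le_anti/andP; split.
  have := bounds _ pG; rewrite PG.
  have [aE|aE|aE] := letter3 (path_a G 0); rewrite aE /lo /hi /= => /andP[? ?].
  + by right; apply: (lo_uniq _ _ pG (G1min_follows n)); rewrite aE ?PG.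
  + by left; apply: (hi_uniq _ _ pG (G2max_follows n)); rewrite aE ?PG.
  + by exfalso; lra.
- have E : Psi (G2max n) = Psi (G1min n) by rewrite E2max E1min.
  case=> ->; split=> //=.
  + by split; [exact: pieceI p2max|rewrite E; exact: pieceI p1min].
  + by split; [rewrite -E; exact: pieceI p2max|exact: pieceI p1min].
- move=> PG; have := bounds _ pG; rewrite PG.
  have [aE|aE|aE] := letter3 (path_a G 0); rewrite aE /lo /hi /= => /andP[? ?].
  + by apply: (hi_uniq _ _ pG (Gmax_follows n)); rewrite aE ?PG.
  + by exfalso; lra.
  + by exfalso; lra.
- by move=> ->; split=> //=; rewrite Emax.
Qed.
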